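(* Let $k\ge1$ be an integer. Then, as power series in $q$ ($|q|<1$), $$\sum_{n=0}^{\infty}N_{3,k}(n)q^n=q\,\frac{(q^{16},-q^2,-q^{14};q^{16})_\infty}{(q;q^2)_{\infty}^{k-1}(q^2;q^2)_{\infty}^k}.$$
   Context: Notation: $(a;q)_\infty=\prod_{j\ge0}(1-aq^j)$ and $(a_1,\dots,a_r;q)_\infty=\prod_{i=1}^r(a_i;q)_\infty$. A $k$-color partition of $n$ is a finite multiset of positive integers (parts), each carrying one of the $k$ colors $color(1),\dots,color(k)$, whose sum is $n$; repetitions are allowed. $\mathcal{N}_k(n)$ is the set of $k$-color partitions of $n$ in which even parts may occur only in the $k-1$ colors $color(2),\dots,color(k)$ (odd parts may occur in all $k$ colors). $N_{3,k}(n)$ is the number of partitions in $\mathcal{N}_k(n)$ in which the number of odd parts in $color(k)$, counted with multiplicity, is odd. *)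

(* Defs.v *)
From mathcomp Require Import all_boot all_order all_algebra.
From mathcomp Require Import finmap multiset.
From mathcomp Require Import all_classical all_reals all_analysis.
From mathcomp Require Import complex.
Import numFieldNormedType.Exports.
Set Implicit Arguments.
Unset Strict Implicit.
Unset Printing Implicit Defensive.
Import Order.TTheory GRing.Theory Num.Theory.
Local Open Scope classical_set_scope.
Local Open Scope ring_scope.

(* The topology provided by numFieldNormedType is attached to the coercion
   from numFieldType, hence this packed version of R[i]. *)
Definition complexField (R : realType) : numFieldType := R[i].

Section QPochhammer.
Variable K : numFieldType.

Definition qpoch (a q : K) : K :=
  limn (fun n : nat => \prod_(0 <= j < n) (1 - a * q ^+ j)).

Definition qpochs (s : seq K) (q : K) : K := \prod_(a <- s) qpoch a q.

End QPochhammer.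

Local Open Scope nat_scope.

(* An element (p, c) is a part p carrying color(c + 1): colors are indexed
   from 0, so color(1) is index 0 and color(k) is index k.-1. *)
Definition color_partition (k n : nat) (m : multiset (nat * 'I_k)%type) : bool :=
  all (fun x => 0 < x.1) m && (\sum_(x <- m) x.1 == n).

Definition Nset (k n : nat) : set (multiset (nat * 'I_k)%type) :=
  [set m | color_partition n m /\
           {in m, forall x : nat * 'I_k, ~~ odd x.1 -> 0 < x.2}].

Definition odd_last (k : nat) (m : multiset (nat * 'I_k)%type) : nat :=
  count (fun x : nat * 'I_k => odd x.1 && (x.2 == k.-1 :> nat)) m.

Definition N3set (k n : nat) : set (multiset (nat * 'I_k)%type) :=
  [set m | Nset n m /\ odd (odd_last m)].

(* fset_set is only meaningful on finite sets *)
Lemma finite_Nset (k n : nat) : finite_set (@Nset k n).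
Proof.
pose f (t : n.-bseq ('I_n.+1 * 'I_k)) : multiset (nat * 'I_k)%type :=
  seq_mset [seq (val x.1, x.2) | x <- t].
apply: (@sub_finite_set _ _ (f @` [set: n.-bseq ('I_n.+1 * 'I_k)])); last first.
  exact/finite_image/finite_finset.
move=> m [/andP[/allP pos /eqP sm] _] /=.
have szm : size m <= n.
  rewrite -sm -sum1_size big_seq [leqRHS]big_seq.
  by apply: leq_sum => x /pos.
have lem x : x \in (m : seq _) -> x.1 <= n.
  by move=> xm; rewrite -sm (big_rem x) //= leq_addr.
pose s := [seq (inord x.1 : 'I_n.+1, x.2) | x <- m].
have ss : size s <= n by rewrite size_map.
exists (Bseq ss) => //; rewrite /f /= -map_comp -[RHS]seq_mset_id.
congr seq_mset; rewrite -[RHS]map_id; apply/eq_in_map => -[p c] /lem /= le_pn.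
by rewrite inordK.
Qed.

Definition N3 (k n : nat) : nat := #|` fset_set (@N3set k n)|.

(* Main.v *)
Require Import Defs.
From mathcomp Require Import all_boot all_order all_algebra.
From mathcomp Require Import finmap multiset.
From mathcomp Require Import all_classical all_reals all_analysis.
From mathcomp Require Import complex.
From mathcomp Require Import ring lra zify.
Import numFieldNormedType.Exports.
Set Implicit Arguments.
Unset Strict Implicit.
Unset Printing Implicit Defensive.
Import Order.TTheory GRing.Theory Num.Theory.
Local Open Scope classical_set_scope.
Local Open Scope ring_scope.

(* Give every odd part of the last color the weight 1 or -1: the difference of
   the two generating functions is twice the series of N_{3,k}, and the claim
   becomes
     (q^2;q^2) ((-q;q^2) - (q;q^2))
       = 2 q (q^16,-q^2,-q^14;q^16) (q;q^2) (-q;q^2).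
   By the Jacobi triple product, (q^4;q^4) (-q;q^2) = sum_m q^(2m^2+m), where
   the parity of the exponent is that of m; its odd part, with m = 2l + 1, is
   again a triple product, in base q^16.
   These identities are proved for polynomials modulo X^n. The passage to the
   limit rests on one estimate: if X^n divides T and sum_i |T_i| x^i <= C for
   some x with |q| < x < 1, then |T(q)| <= C (|q|/x)^n; the constant C is
   uniform in n because all the finite products are dominated by the
   prod_j (1 - x^(j+1))^-1. *)

(** * Finite triple product *)

Definition qfac (R : comNzRingType) (a Q : R) (n : nat) : R :=
  \prod_(0 <= j < n) (1 - a * Q ^+ j).

Lemma qfacS (R : comNzRingType) (a Q : R) n :
  qfac a Q n.+1 = qfac a Q n * (1 - a * Q ^+ n).
Proof. by rewrite /qfac big_nat_recr. Qed.

Lemma qfac0 (R : comNzRingType) (a Q : R) : qfac a Q 0 = 1.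
Proof. by rewrite /qfac big_nil. Qed.

Section QBinomial.
Variables (R : comNzRingType) (Q : R).

(** The Gaussian binomial coefficient, defined by a q-Pascal rule instead of a quotient so that it
    exists in every commutative ring. *)
Fixpoint qbin (n k : nat) : R :=
  match n, k with
  | _, 0 => 1
  | 0, _.+1 => 0
  | n'.+1, k'.+1 => qbin n' k'.+1 + Q ^+ (n' - k') * qbin n' k'
  end.

Lemma qbinn0 n : qbin n 0 = 1. Proof. by case: n. Qed.

Lemma qbinS n k : qbin n.+1 k.+1 = qbin n k.+1 + Q ^+ (n - k) * qbin n k.
Proof. by []. Qed.

Lemma qbin_small n k : (n < k)%N -> qbin n k = 0.
Proof.
elim: n k => [|n IHn] [|k] //; rewrite ltnS => ltnk.
by rewrite qbinS !IHn ?mulr0 ?addr0 // ltnW.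
Qed.

(** The dual q-Pascal rule. The finite triple product uses this one to increase [b] and [qbinS] to
    increase [a]. *)
Lemma qbinSr n k : qbin n.+1 k.+1 = qbin n k + Q ^+ k.+1 * qbin n k.+1.
Proof.
elim: n k => [|n IHn] k.
  by rewrite qbinS /= sub0n expr0 mulr0 mul1r add0r addr0.
rewrite qbinS [in LHS]IHn; case: k => [|k].
  by rewrite !qbinn0 !qbinS !qbinn0 !subn0 [Q ^+ n.+1]exprS; ring.
rewrite [in LHS]IHn [qbin n.+1 k.+2]qbinS [X in _ = X + _]qbinS subSS.
have [len|ltn] := leqP k.+1 n.
  have -> : Q ^+ k.+2 = Q * Q ^+ k.+1 by rewrite exprS.
  have -> : (n - k = (n - k.+1).+1)%N by lia.
  by rewrite [Q ^+ (n - k.+1).+1]exprS; ring.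
(* For [n <= k] the truncated subtractions degenerate, but the q-binomials with lower index above
   [n] vanish. *)
have [->|nek] := eqVneq n k; first by rewrite !(@qbin_small k k.+1) // !mulr0 !addr0 !add0r addrC.
by rewrite !(@qbin_small n k.+1) ?(@qbin_small n k.+2) //; try lia; ring.
Qed.

(** The quotient formula for Gaussian binomials, cleared of denominators. *)
Lemma qbin_qfac i j : qfac Q Q i * qfac Q Q j * qbin (i + j) i = qfac Q Q (i + j).
Proof.
elim: i j => [|i IHi] j; first by rewrite qfac0 mul1r qbinn0 mulr1.
elim: j => [|j IHj].
  have := IHi 0%N; rewrite !addn0 qfac0 !mulr1 => IH.
  by rewrite qbinS subnn expr0 mul1r qbin_small // add0r qfacS mulrAC IH.
have := IHi j.+1; rewrite addnS => {}IHi; rewrite addSn in IHj.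
have -> : (i.+1 + j.+1 = (i + j).+2)%N by lia.
rewrite qbinS; have -> : ((i + j).+1 - i = j.+1)%N by lia.
(* The two terms recombine through 1 - Q^(i+j+2) = (1 - Q^(j+1)) + Q^(j+1) (1 - Q^(i+1)). *)
transitivity ((1 - Q * Q ^+ j) * (qfac Q Q i.+1 * qfac Q Q j * qbin (i + j).+1 i.+1)
  + Q ^+ j.+1 * (1 - Q * Q ^+ i) * (qfac Q Q i * qfac Q Q j.+1 * qbin (i + j).+1 i)).
  by rewrite !qfacS; ring.
rewrite IHi IHj [in RHS]qfacS.
have -> : Q ^+ (i + j).+1 = Q * Q ^+ i * Q ^+ j by rewrite exprS exprD; ring.
by rewrite exprS; ring.
Qed.

End QBinomial.
Arguments qbin : simpl never.

Section FiniteTripleProduct.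
Variables (R : comNzRingType) (u v : R).
Let Q := u * v.

(* [theta b k] is the term of index [m = k - b] of the two-sided theta series:
   one of the two truncated subtractions vanishes. *)
Definition theta (b k : nat) : R :=
  v ^+ (b - k) * Q ^+ 'C(b - k, 2) * (u ^+ (k - b) * Q ^+ 'C(k - b, 2)).

(** The second term of the new factor [1 + u * Q ^+ a] shifts the index by one and leaves the power
    of [Q] that occurs in [qbinS]. *)
Lemma theta_mulu a b k : (k <= a + b)%N ->
  theta b k * (u * Q ^+ a) = theta b k.+1 * Q ^+ (a + b - k).
Proof.
move=> kab; rewrite /theta; have [ltkb|lebk] := ltnP k b.
  have [d db] : exists d, (b - k = d.+1)%N by exists (b - k).-1; lia.
  have -> : (b - k.+1 = d)%N by lia.
  have -> : (k - b = 0)%N by lia.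
  have -> : (k.+1 - b = 0)%N by lia.
  have -> : (a + b - k = a + d.+1)%N by lia.
  by rewrite db binS bin1 !exprD !exprS /Q; ring.
have [d dk] : exists d, (k - b = d)%N by eexists.
have -> : (k.+1 - b = d.+1)%N by lia.
have -> : (b - k = 0)%N by lia.
have -> : (b - k.+1 = 0)%N by lia.
have -> : Q ^+ a = Q ^+ (a + b - k) * Q ^+ d by rewrite -exprD; congr (_ ^+ _); lia.
by rewrite dk binS bin1 !exprD !exprS; ring.
Qed.

Lemma theta_mulv b k : (k <= b)%N ->
  theta b k * (v * Q ^+ b) = theta b.+1 k * Q ^+ k.
Proof.
move=> kb; rewrite /theta.
have -> : (k - b = 0)%N by lia.
have -> : (k - b.+1 = 0)%N by lia.
rewrite subSn //.
have -> : Q ^+ b = Q ^+ k * Q ^+ (b - k) by rewrite -exprD; congr (_ ^+ _); lia.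
by rewrite binS bin1 !exprD !exprS; ring.
Qed.

Lemma thetaSS b k : theta b.+1 k.+1 = theta b k.
Proof. by rewrite /theta !subSS. Qed.

(** Cauchy's finite form of the Jacobi triple product, with m = k - b running from -b to a.
    Induction on [b] at [a = 0], then on [a]; each new factor is absorbed by one of the q-Pascal
    rules. *)
Lemma finite_triple_product a b :
  qfac (- u) Q a * qfac (- v) Q b = \sum_(k < (a + b).+1) qbin Q (a + b) k * theta b k.
Proof.
elim: a => [|a IHa].
  rewrite qfac0 mul1r add0n; elim: b => [|b IHb].
    by rewrite big_ord1 qfac0 qbinn0 /theta /= !expr0 !mulr1.
  rewrite qfacS IHb mulNr opprK mulrDr mulr1.
  rewrite [RHS]big_ord_recl /= qbinn0 mul1r.
  under [in RHS]eq_bigr => k _.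
    rewrite (_ : bump 0 k = k.+1) // (qbinSr Q b k) thetaSS mulrDl; over.
  rewrite big_split /= addrCA; congr (_ + _).
  rewrite mulr_suml.
  under [LHS]eq_bigr => k _.
    rewrite -mulrA theta_mulv; last by rewrite -ltnS.
    over.
  rewrite [LHS]big_ord_recl /= qbinn0 expr0 mulr1 mul1r; congr (_ + _).
  rewrite [in RHS]big_ord_recr /= qbin_small // mulr0 mul0r addr0.
  apply: eq_bigr => k _; rewrite (_ : bump 0 k = k.+1) // thetaSS; ring.
rewrite qfacS mulrAC IHa mulNr opprK mulrDr mulr1 addSn.
rewrite [RHS]big_ord_recl /= qbinn0 mul1r.
under [in RHS]eq_bigr => k _.
  rewrite (_ : bump 0 k = k.+1) // (qbinS Q (a + b) k) mulrDl; over.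
rewrite big_split /= addrA; congr (_ + _).
  rewrite big_ord_recl qbinn0 mul1r; congr (_ + _).
  by rewrite [in RHS]big_ord_recr /= qbin_small // mul0r addr0.
rewrite mulr_suml; apply: eq_bigr => k _.
by rewrite -[LHS]mulrA theta_mulu -1?ltnS //; ring.
Qed.

End FiniteTripleProduct.

(** * Congruences modulo X^n *)

Section TruncatedCongruence.
Variable K : fieldType.
Implicit Types (p q r a u v Q : {poly K}) (n : nat).

Definition eqX n p q := 'X^n %| p - q.

Lemma eqXxx n p : eqX n p p.
Proof. by rewrite /eqX subrr dvdp0. Qed.

Lemma eqX_sym n p q : eqX n p q -> eqX n q p.
Proof. by rewrite /eqX -opprB dvdpNr. Qed.

Lemma eqX_trans n q p r : eqX n p q -> eqX n q r -> eqX n p r.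
Proof. by move=> pq qr; rewrite /eqX -(subrKA q) dvdp_add. Qed.

Lemma eqXD n p q p' q' : eqX n p q -> eqX n p' q' -> eqX n (p + p') (q + q').
Proof. by move=> pq pq'; rewrite /eqX opprD addrACA dvdp_add. Qed.

Lemma eqXN n p q : eqX n p q -> eqX n (- p) (- q).
Proof. by rewrite /eqX -opprD dvdpNr. Qed.

Lemma eqXB n p q p' q' : eqX n p q -> eqX n p' q' -> eqX n (p - p') (q - q').
Proof. by move=> pq pq'; apply: eqXD => //; apply: eqXN. Qed.

Lemma eqXM n p q p' q' : eqX n p q -> eqX n p' q' -> eqX n (p * p') (q * q').
Proof.
move=> pq pq'; rewrite /eqX.
have -> : p * p' - q * q' = (p - q) * p' + q * (p' - q') by ring.
by apply: dvdp_add; [apply: dvdp_mulr | apply: dvdp_mull].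
Qed.

Lemma eqX_sum n I (s : seq I) (P : pred I) (F G : I -> {poly K}) :
  (forall i, P i -> eqX n (F i) (G i)) ->
  eqX n (\sum_(i <- s | P i) F i) (\sum_(i <- s | P i) G i).
Proof.
move=> FG; apply: (big_ind2 (eqX n)) => //; first exact: eqXxx.
by move=> p q r s0; exact: eqXD.
Qed.

Lemma eqX_prod n I (s : seq I) (P : pred I) (F G : I -> {poly K}) :
  (forall i, P i -> eqX n (F i) (G i)) ->
  eqX n (\prod_(i <- s | P i) F i) (\prod_(i <- s | P i) G i).
Proof.
move=> FG; apply: (big_ind2 (eqX n)) => //; first exact: eqXxx.
by move=> p q r s0; exact: eqXM.
Qed.

Lemma eqXW m n p q : (m <= n)%N -> eqX n p q -> eqX m p q.
Proof. by move=> mn; apply: dvdp_trans; rewrite dvdp_exp2l. Qed.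

(** A nonzero constant term makes [u] coprime to ['X^n]. *)
Lemma eqX_cancel n u p q : ~~ root u 0 -> eqX n (u * p) (u * q) -> eqX n p q.
Proof.
move=> u0; rewrite /eqX -mulrBr Gauss_dvdpr //.
by apply: coprimep_expl; rewrite coprimep_sym coprimepX.
Qed.

Lemma dvdp_exprX p n : 'X %| p -> 'X^n %| p ^+ n.
Proof. by move=> Xp; rewrite dvdp_exp2r. Qed.

(** The factors of index at least [n] are 1 modulo ['X^n]. *)
Lemma qfac_eqX a Q n m : 'X %| Q -> (n <= m)%N -> eqX n (qfac a Q m) (qfac a Q n).
Proof.
move=> XQ /subnK <-; elim: (m - n)%N => [|i IHi]; first exact: eqXxx.
rewrite addSn qfacS -[X in eqX _ _ X]mulr1; apply: eqXM => //.
rewrite /eqX addrAC subrr add0r dvdpNr dvdp_mull //.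
by apply: dvdp_trans (dvdp_exprX _ XQ); rewrite dvdp_exp2l // leq_addl.
Qed.

Lemma qfac_root0 a Q n : 'X %| a -> ~~ root (qfac a Q n) 0.
Proof.
rewrite -['X]subr0 -polyC0 dvdp_XsubCl => /rootP a0; rewrite /root horner_prod.
by rewrite big1 ?oner_eq0 // => j _; rewrite !hornerE a0 mul0r subr0.
Qed.

(** The exponent is n - |k - n|, the minimum of k and 2n - k. At that precision all the q-factorials
    in the quotient formula agree, so they cancel. The loss of |k - n| is made up by the
    divisibility of [theta u v n k]. *)
Lemma qbin_eqX Q n k : 'X %| Q -> (k <= n + n)%N ->
  eqX (n - ((n - k) + (k - n))) (qfac Q Q n * qbin Q (n + n) k) 1.
Proof.
move=> XQ kn; set m := (n - _)%N.
have /(_ (n + n - k)%N) := qbin_qfac Q k; rewrite subnKC // => E.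
have qm i : (m <= i)%N -> eqX m (qfac Q Q i) (qfac Q Q m) by exact: qfac_eqX.
apply: (@eqX_trans _ (qfac Q Q m * qbin Q (n + n) k)).
  by apply: eqXM; [apply: qm; rewrite /m; lia | exact: eqXxx].
apply: (@eqX_cancel _ (qfac Q Q m)); first exact: qfac_root0.
rewrite mulr1 mulrA.
apply: (@eqX_trans _ (qfac Q Q (n + n))); last by apply: qm; rewrite /m; lia.
apply: eqX_sym; rewrite -E; apply: eqXM (eqXxx _ _).
by apply: eqXM; apply: qm; rewrite /m; lia.
Qed.

Lemma triple_product_eqX u v n : 'X %| u -> 'X %| v ->
  eqX n (qfac (u * v) (u * v) n * (qfac (- u) (u * v) n * qfac (- v) (u * v) n))
    (\sum_(m < n) u ^+ m * (u * v) ^+ 'C(m, 2) +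
     \sum_(m < n) v ^+ m.+1 * (u * v) ^+ 'C(m.+1, 2)).
Proof.
move=> Xu Xv; have Xuv : 'X %| u * v by rewrite dvdp_mulr.
rewrite finite_triple_product mulr_sumr.
have Xtheta k : 'X^((n - k) + (k - n)) %| theta u v n k.
  rewrite exprD; apply: dvdp_mul; apply: dvdp_mulr; exact: dvdp_exprX.
apply: (@eqX_trans _ (\sum_(k < (n + n).+1) theta u v n k)).
  apply: eqX_sum => k _; rewrite mulrA /eqX -{2}[theta _ _ _ _]mul1r -mulrBl.
  have nk : (n - k + (k - n) <= n)%N by have := ltn_ord k; lia.
  rewrite -{1}(subnK nk) exprD dvdp_mul //.
  by apply: qbin_eqX; rewrite -1?ltnS.
(* The last index k = 2n, that is m = n, contributes a multiple of ['X^n] and is dropped; the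
   indices below n, read backwards, give the negative m. *)
rewrite big_ord_recr big_split_ord /= addrC.
rewrite -[X in eqX _ _ X]add0r; apply: eqXD.
  rewrite /eqX subr0; apply: dvdp_trans (Xtheta _).
  by rewrite dvdp_exp2l //; lia.
rewrite addrC [X in _ + X](reindex_inj rev_ord_inj) /=.
have -> : \sum_(i < n) theta u v n (n + i) = \sum_(m < n) u ^+ m * (u * v) ^+ 'C(m, 2).
  apply: eq_bigr => i _; rewrite /theta addKn.
  have -> : (n - (n + i) = 0)%N by lia.
  by rewrite /= !expr0 !mul1r.
have -> : \sum_(j < n) theta u v n (n - j.+1) =
    \sum_(m < n) v ^+ m.+1 * (u * v) ^+ 'C(m.+1, 2).
  apply: eq_bigr => i _; rewrite /theta; have ltin := ltn_ord i.
  have -> : (n - (n - i.+1) = i.+1)%N by lia.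
  have -> : (n - i.+1 - n = 0)%N by lia.
  by rewrite /= !expr0 !mulr1.
exact: eqXxx.
Qed.

End TruncatedCongruence.

(** * Parity dissection of the theta series *)

Lemma qfac_even_odd (R : comNzRingType) (a Q : R) n :
  qfac a Q (n + n) = qfac a (Q ^+ 2) n * qfac (a * Q) (Q ^+ 2) n.
Proof.
elim: n => [|n IHn]; first by rewrite !qfac0 mulr1.
by rewrite addSn addnS !qfacS IHn -exprM mul2n -addnn [Q ^+ (n + n).+1]exprSr; ring.
Qed.

Lemma qfac_conj (R : comNzRingType) (a Q : R) n :
  qfac a Q n * qfac (- a) Q n = qfac (a ^+ 2) (Q ^+ 2) n.
Proof.
elim: n => [|n IHn]; first by rewrite !qfac0 mulr1.
by rewrite !qfacS -IHn -exprM mulnC exprM; ring.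
Qed.

Lemma sum_even_odd (V : zmodType) (F : nat -> V) n :
  \sum_(m < n + n) F m = \sum_(l < n) (F l.*2 + F l.*2.+1).
Proof.
elim: n => [|n IHn]; first by rewrite !big_ord0.
by rewrite addSn addnS 2!big_ord_recr IHn big_ord_recr /= -addnn addrA.
Qed.

(** Changing the sign of [y] cancels the even powers and doubles the odd ones. *)
Lemma sum_expr_signl (R : comNzRingType) (y : R) (Z : nat -> R) n :
  \sum_(m < n + n) (1 * y) ^+ m * Z m - \sum_(m < n + n) (-1 * y) ^+ m * Z m =
  \sum_(l < n) 2 * (y ^+ l.*2.+1 * Z l.*2.+1).
Proof.
rewrite (sum_even_odd (fun m => (1 * y) ^+ m * Z m)).
rewrite (sum_even_odd (fun m => (-1 * y) ^+ m * Z m)).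
rewrite -sumrB; apply: eq_bigr => l _.
rewrite !exprMn !expr1n -[(-1) ^+ l.*2]signr_odd -[(-1) ^+ l.*2.+1]signr_odd /=.
by rewrite odd_double; ring.
Qed.

(** Here the exponent is one ahead of the index, so it is the even indices that survive. *)
Lemma sum_expr_signr (R : comNzRingType) (y : R) (Z : nat -> R) n :
  \sum_(m < n + n) (1 * y) ^+ m.+1 * Z m - \sum_(m < n + n) (-1 * y) ^+ m.+1 * Z m =
  \sum_(l < n) 2 * (y ^+ l.*2.+1 * Z l.*2).
Proof.
rewrite (sum_even_odd (fun m => (1 * y) ^+ m.+1 * Z m)).
rewrite (sum_even_odd (fun m => (-1 * y) ^+ m.+1 * Z m)).
rewrite -sumrB; apply: eq_bigr => l _.
rewrite !exprMn !expr1n -[(-1) ^+ l.*2.+1]signr_odd -[(-1) ^+ l.*2.+2]signr_odd /=.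
by rewrite odd_double; ring.
Qed.

Section OddPart.
Variable K : fieldType.
Implicit Types (p q r a u v Q : {poly K}) (n : nat).

(** [T e] is the theta series for u = e x^3, v = e x. Its odd terms have exponents 8l^2 + 10l + 3
    (from m = 2l + 1) and 8l^2 + 6l + 1 (from m = -(2l + 1)). They match the [x ^+ 2] and the
    [x ^+ 14] sums respectively, so the two halves change places. *)
Lemma odd_theta_diff (x : {poly K}) n :
  let T e := \sum_(m < n + n) (e * x ^+ 3) ^+ m * (x ^+ 4) ^+ 'C(m, 2) +
     \sum_(m < n + n) (e * x) ^+ m.+1 * (x ^+ 4) ^+ 'C(m.+1, 2) in
  T 1 - T (- 1) =
  2 * (x * (\sum_(m < n) (x ^+ 14) ^+ m * (x ^+ 16) ^+ 'C(m, 2) +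
     \sum_(m < n) (x ^+ 2) ^+ m.+1 * (x ^+ 16) ^+ 'C(m.+1, 2))).
Proof.
move=> T; rewrite /T [in RHS]addrC mulrDr mulrDr opprD addrACA.
have bin_odd l : 'C(l.*2.+1, 2) = (l * l.*2.+1)%N.
  by rewrite bin2 /= mulnC -doubleMl doubleK.
have dbl_bin l : ('C(l, 2).*2 = l * l.-1)%N.
  by rewrite bin2 -[RHS]odd_double_half; case: l => //= l; rewrite oddM oddS andNb.
congr (_ + _).
  rewrite (sum_expr_signl (x ^+ 3) (fun m => (x ^+ 4) ^+ 'C(m, 2))).
  rewrite !mulr_sumr; apply: eq_bigr => l _; congr (_ * _).
  rewrite -!exprM -!exprD -exprS; congr (_ ^+ _).
  by rewrite bin_odd; have := dbl_bin l.+1; rewrite /=; nia.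
rewrite (sum_expr_signr x (fun m => (x ^+ 4) ^+ 'C(m.+1, 2))).
rewrite !mulr_sumr; apply: eq_bigr => l _; congr (_ * _).
rewrite -!exprM -!exprD -exprS; congr (_ ^+ _).
by rewrite bin_odd; have := dbl_bin l; case: (nat_of_ord l) => [|i] /=; nia.
Qed.

(** The factorization (x^2;x^2) = (x;x^2) (-x;x^2) (x^4;x^4), which is [C2], reduces the left side
    to the difference of two triple products, [TE] at e = 1 and e = -1. *)
Lemma odd_part_eqX x n : 'X %| x ->
  @eqX K n (qfac (x ^+ 2) (x ^+ 2) n * (qfac (- x) (x ^+ 2) n - qfac x (x ^+ 2) n))
    (2 * (x * (qfac (x ^+ 16) (x ^+ 16) n * (qfac (- x ^+ 14) (x ^+ 16) n * qfac (- x ^+ 2) (x ^+ 16) n)))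
     * (qfac x (x ^+ 2) n * qfac (- x) (x ^+ 2) n)).
Proof.
(* An even number of terms splits exactly into even and odd indices; everything is compared modulo
   ['X^n] only. *)
move=> Xx; pose N := (n + n)%N.
pose T (e : {poly K}) := \sum_(m < N) (e * x ^+ 3) ^+ m * x ^+ 4 ^+ 'C(m, 2) +
  \sum_(m < N) (e * x) ^+ m.+1 * x ^+ 4 ^+ 'C(m.+1, 2).
have X_Xn i : 'X %| x ^+ i.+1 by rewrite exprS dvdp_mulr.
have nN : (n <= N)%N by exact: leq_addr.
have nNN : (n <= N + N)%N by rewrite (leq_trans nN) ?leq_addr.
have TE e : e * e = 1 -> @eqX K n (qfac (x ^+ 4) (x ^+ 4) N * qfac (- (e * x)) (x ^+ 2) n) (T e).
  move=> ee; have /= := @triple_product_eqX K (e * x ^+ 3) (e * x) N.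
  have -> : e * x ^+ 3 * (e * x) = x ^+ 4.
    by rewrite mulrACA ee mul1r -exprSr.
  rewrite !dvdp_mull // => /(_ isT isT) /(eqXW nN); apply: eqX_trans.
  apply: eqXM; first exact: eqXxx.
  (* The two products in base x^4 interleave into the single product (-e x; x^2). *)
  have -> : - (e * x ^+ 3) = - (e * x) * x ^+ 2.
    by rewrite mulNr -mulrA -exprS.
  have -> : x ^+ 4 = x ^+ 2 ^+ 2 :> {poly K} by rewrite -exprM.
  rewrite [X in eqX _ _ X]mulrC -qfac_even_odd.
  by apply: eqX_sym; apply: qfac_eqX.
have C2 : @eqX K n (qfac (x ^+ 2) (x ^+ 2) n)
    (qfac x (x ^+ 2) n * qfac (- x) (x ^+ 2) n * qfac (x ^+ 4) (x ^+ 4) N).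
  apply: (@eqX_trans _ _ (qfac (x ^+ 2) (x ^+ 2) (N + N))).
    by apply: eqX_sym; apply: qfac_eqX.
  rewrite qfac_even_odd.
  have X4 : x ^+ 2 * x ^+ 2 = x ^+ 4 :> {poly K} by rewrite -exprD.
  rewrite [_ ^+ 2 ^+ 2]expr2 X4; apply: eqXM; [|exact: eqXxx].
  by rewrite qfac_conj [_ ^+ 2 ^+ 2]expr2 X4; apply: qfac_eqX.
apply: eqX_trans (eqXM C2 (eqXxx n _)) _.
rewrite [X in eqX _ _ X]mulrC -[X in eqX _ X _]mulrA; apply: eqXM; first exact: eqXxx.
rewrite mulrBr.
have := TE 1 (mulr1 _); rewrite mul1r => T1.
have := TE (- 1); rewrite mulrNN mulr1 mulN1r opprK => /(_ erefl) TN1.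
apply: eqX_trans (eqXB T1 TN1) _; rewrite /T odd_theta_diff.
apply: eqXM; first exact: eqXxx.
apply: eqXM; first exact: eqXxx.
apply: eqX_sym; have := @triple_product_eqX K (x ^+ 14) (x ^+ 2) n (X_Xn _) (X_Xn _).
by rewrite -exprD.
Qed.

End OddPart.

(** * Colored partitions *)

Lemma sum_count_mem (T : eqType) (I : finType) (h : I -> T) (s : seq T)
    (F : T -> nat) : injective h -> {subset s <= codom h} ->
  (\sum_(x <- s) F x = \sum_i count_mem (h i) s * F (h i))%N.
Proof.
move=> h_inj; elim: s => [|x s IHs] sh.
  by rewrite big_nil big1 // => i _; rewrite mul0n.
have /codomP[i0 xh] : x \in codom h by apply: sh; rewrite mem_head.
rewrite big_cons IHs => [|y ys]; last by apply: sh; rewrite inE ys orbT.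
under [in RHS]eq_bigr => i _ do rewrite /= mulnDl.
rewrite big_split /= xh [X in _ = (X + _)%N](bigD1 i0) //= eqxx mul1n.
rewrite [X in _ = (_ + X + _)%N]big1 ?addn0 // => i ii0.
by rewrite (inj_eq h_inj) eq_sym (negPf ii0) mul0n.
Qed.

Section PartitionCount.
Variables (k n : nat).
Hypothesis n_gt0 : (0 < n)%N.
Local Notation I := ('I_(n + n) * 'I_k)%type.

Definition part (i : I) : nat := i.1.+1.
Definition allowed (i : I) : bool := odd (part i) || (0 < i.2)%N.
Definition marked (i : I) : bool := odd (part i) && (i.2 == k.-1 :> nat).

Definition weight (f : {ffun I -> 'I_n}) : nat := \sum_i f i * part i.
Definition marks (f : {ffun I -> 'I_n}) : nat := \sum_i f i * marked i.
(** A partition is encoded by the multiplicity of each colored part, so that the partitions in play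
    form a finite type indexing the expansion of a product. Letting the parts run up to 2n gives
    exactly n odd and n even ones. *)
Definition multiplicities : {set {ffun I -> 'I_n}} :=
  [set f : {ffun I -> 'I_n} | [forall i, allowed i || (f i == 0 :> nat)]].

Let h (i : I) : nat * 'I_k := (part i, i.2).

Let h_inj : injective h.
Proof. by move=> [i c] [j d] [] /ord_inj -> ->. Qed.

Definition mset_of (f : {ffun I -> 'I_n}) : multiset (nat * 'I_k)%type :=
  seq_mset (flatten [seq nseq (f i) (h i) | i <- enum {: I}]).

Lemma mset_ofE f i : mset_of f (h i) = f i.
Proof.
rewrite mset_seqE count_flatten -map_comp sumnE big_map big_enum /= (bigD1 i) //=.
rewrite count_nseq /= eqxx mul1n big1 ?addn0 // => j ji.
by rewrite count_nseq /= (inj_eq h_inj) (negPf ji).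
Qed.

Lemma mset_of_codom f : {subset mset_of f <= codom h}.
Proof.
move=> x; rewrite in_mset mset_seqE -has_count has_pred1.
by move=> /flatten_mapP[i _ /nseqP[-> _]]; apply: codom_f.
Qed.

Lemma mset_of_inj : injective mset_of.
Proof. by move=> f f' ff'; apply/ffunP => i; apply: ord_inj; rewrite -!mset_ofE ff'. Qed.

Lemma sum_mset_of f (F : nat * 'I_k -> nat) :
  (\sum_(x <- mset_of f) F x = \sum_i f i * F (h i))%N.
Proof.
rewrite (sum_count_mem _ h_inj) //; last exact: mset_of_codom.
by apply: eq_bigr => i _; rewrite count_mem_mset mset_ofE.
Qed.

Lemma N3set_mset_of m f : N3set m (mset_of f) <->
  [/\ f \in multiplicities, weight f = m & odd (marks f)].
Proof.
have -> : N3set m (mset_of f) <-> (Nset m (mset_of f) /\ odd (marks f)).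
  rewrite /N3set /= (_ : odd_last _ = marks f) //.
  rewrite /odd_last -sum1_count big_mkcond sum_mset_of; apply: eq_bigr => i _.
  by rewrite /marked /=; case: (_ && _).
have mem_h i : (h i \in mset_of f) = (f i != 0 :> nat).
  by rewrite in_mset mset_ofE lt0n.
rewrite /Nset /color_partition /= sum_mset_of -/(weight f) inE.
split=> [[[/andP[_ /eqP wf] col] om]|[/forallP fam wf om]]; split=> //.
  apply/forallP => i; rewrite orbC -implyNb; apply/implyP; rewrite -mem_h => /col.
  by rewrite /allowed /= negbK; case: odd => //= ->.
split; first by rewrite wf eqxx andbT; apply/allP => x /mset_of_codom /codomP[i ->].
move=> x xf; have /codomP[i xi] := mset_of_codom xf; move: xf; rewrite xi mem_h => fi0.
by have := fam i; rewrite (negPf fi0) orbF /allowed => /orP[->|].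
Qed.

(** A part times its multiplicity is at most m < n, so neither exceeds the bounds of the
    encoding. *)
Lemma mset_of_surj m s : (m < n)%N -> Nset m s -> exists f, mset_of f = s.
Proof.
move=> mn [/andP[/allP pos /eqP ws] _].
have le_s x : x \in s -> (x.1 * s x <= m)%N.
  move=> xs; rewrite -ws (sum_mset s predT) (big_fsetD1 x) ?msuppE //= mulnC.
  exact: leq_addr.
(* The default of [insubd], multiplicity 0, is taken only for values at least [n], which [le_s]
   excludes. *)
pose f := [ffun i : I => insubd (Ordinal n_gt0) (s (h i))].
exists f; apply/msetP => x; have [xs|xNs] := boolP (x \in s); last first.
  rewrite (mset_eq0P xNs); apply/mset_eq0P.
  apply: contra xNs => xf; have /codomP[i xi] := mset_of_codom xf; move: xf.
  rewrite xi !in_mset mset_ofE ffunE val_insubd; case: ifP => //.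
have x_gt0 := pos _ xs; have lex := le_s _ xs; have sx : (0 < s x)%N by rewrite -in_mset.
have x1 : (x.1.-1 < n + n)%N by nia.
have -> : x = h (Ordinal x1, x.2) by rewrite /h /part /= prednK //; case: (x).
rewrite mset_ofE ffunE val_insubd ifT //.
rewrite /h /part /= prednK // -surjective_pairing.
by rewrite (leq_ltn_trans _ mn) // (leq_trans _ lex) // leq_pmull.
Qed.

Lemma N3_card m : (m < n)%N ->
  N3 k m = #|[set f in multiplicities | (weight f == m) && odd (marks f)]|.
Proof.
move=> mn; set D := [set f in _ | _].
have <- : #|` [fset mset_of f | f in D]%fset| = #|D|.
  by rewrite card_imfset ?cardE //; exact: mset_of_inj.
congr #|` _|; apply/fsetP => s; rewrite in_fset_set; last first.
  by apply: sub_finite_set (finite_Nset k m) => ? [].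
apply/idP/imfsetP => /= [|[f]].
  rewrite inE => Ns; have [f fs] := mset_of_surj mn Ns.1; exists f => //=.
  by move: Ns; rewrite -fs N3set_mset_of !inE => -[-> -> ->]; rewrite eqxx.
rewrite /D 2!inE => /and3P[f_in /eqP wf om] ->.
exact/N3set_mset_of.
Qed.

End PartitionCount.

(** * Generating functions as finite products *)

Section GeneratingFunction.
Variables (k n : nat).
Hypothesis n_gt0 : (0 < n)%N.
Local Notation I := ('I_(n + n) * 'I_k)%type.

(** The flag [b] switches on the sign of the odd parts of the last color; [false] gives the plain
    generating function. *)
Definition twist (R : comNzRingType) (x : R) (b : bool) (i : I) : R :=
  (-1) ^+ (b * marked i) * x ^+ part i.

(* Parts are at most 2n and multiplicities below n, which loses nothing modulo
   x^n. *)
Definition genfun (R : comNzRingType) (x : R) (b : bool) : R :=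
  \prod_(i : I) \sum_(j < n | allowed i || (j == 0 :> nat)) twist x b i ^+ j.

Lemma genfunE (R : comNzRingType) (x : R) b :
  genfun x b = \sum_(f in multiplicities k n) (-1) ^+ (b * marks f) * x ^+ weight f.
Proof.
rewrite /genfun bigA_distr_big_dep.
apply: eq_big => [f|f _].
  by rewrite [RHS]inE; apply/familyP/forallP => H i; exact: H.
under eq_bigr => i _ do rewrite exprMn -!exprM.
rewrite big_split /= !prodrXr; congr ((-1) ^+ _ * x ^+ _).
  by rewrite /marks big_distrr /=; apply: eq_bigr => i _; rewrite mulnAC mulnA.
by apply: eq_bigr => i _; rewrite mulnC.
Qed.

Lemma coef_genfun (K : fieldType) b m : (genfun ('X : {poly K}) b)`_m =
  \sum_(f in multiplicities k n | weight f == m) (-1) ^+ (b * marks f).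
Proof.
rewrite genfunE.
under eq_bigr => f _.
  have -> : (-1) ^+ (b * marks f) * 'X^(weight f) =
     (-1) ^+ (b * marks f) *: 'X^(weight f) :> {poly K}.
    by rewrite -mul_polyC rmorphXn rmorphN1.
  over.
by rewrite coef_sumMXn.
Qed.

(** A partition contributes 1 - (-1)^marks, which is 2 or 0 according to the parity of its marks. *)
Lemma coef_genfun_diff (K : fieldType) m : (m < n)%N ->
  (genfun 'X false - genfun 'X true : {poly K})`_m = (2 * N3 k m)%:R.
Proof.
move=> mn; rewrite coefB !coef_genfun -sumrB (N3_card k n_gt0 mn).
rewrite -sum1_card mulnC big_distrl natr_sum /=.
rewrite [RHS](eq_bigl (fun f => (f \in multiplicities k n) && (weight f == m) &&
   odd (marks f))) => [|f]; last by rewrite !inE andbA.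
rewrite [RHS]big_mkcondr /=; apply: eq_bigr => f _.
rewrite mul0n mul1n expr0 -signr_odd; case: odd; rewrite ?expr1 ?expr0 ?subrr //.
by rewrite opprK.
Qed.

(** Forgetting the parity condition bounds [N3] by a coefficient of a product with nonnegative
    coefficients, to which majorants apply. *)
Lemma N3_le_coef_genfun (K : numFieldType) m : (m < n)%N ->
  (N3 k m)%:R <= (genfun ('X : {poly K}) false)`_m.
Proof.
move=> mn; rewrite coef_genfun (N3_card k n_gt0 mn).
under eq_bigr do rewrite mul0n expr0.
rewrite sumr_const ler_nat; apply: subset_leq_card.
apply/fintype.subsetP => f; rewrite [in X in _ -> X]unfold_in.
by rewrite !inE => /and3P[-> ->].
Qed.

(** Each allowed factor is a truncated geometric sum, with (1 - t) (1 + ... + t^(n-1)) = 1 - t^n and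
    ['X] dividing t. A forbidden factor reduces to its term j = 0. *)
Lemma genfun_inverse (K : fieldType) (x : {poly K}) b : 'X %| x ->
  eqX n (genfun x b * \prod_(i : I | allowed i) (1 - twist x b i)) 1.
Proof.
move=> Xx; rewrite [X in _ * X]big_mkcond -big_split /=.
have prod1 : \prod_(i : I) (1 : {poly K}) = 1 by rewrite big1.
rewrite -[X in eqX _ _ X]prod1.
apply: eqX_prod => i _; case: (allowed i) => /=; last first.
  rewrite (big_pred1 (Ordinal n_gt0)) //.
  rewrite expr0 mulr1; exact: eqXxx.
rewrite mulrC -opprB mulNr -subrX1 opprB.
rewrite /eqX addrAC subrr add0r dvdpNr dvdp_exprX //.
by rewrite dvdp_mull // /part exprS dvdp_mulr.
Qed.

End GeneratingFunction.

(** The parts are taken in pairs 2m + 1, 2m + 2. The odd part has k plain colors and the last,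
    twisted one; the even part loses the first color and keeps k plain factors, since no even part
    is marked. *)
Lemma prod_allowed (R : comNzRingType) (x : R) (b : bool) (k n : nat) :
  \prod_(i : 'I_(n + n) * 'I_k.+1 | allowed i) (1 - twist x b i) =
  qfac x (x ^+ 2) n ^+ k * qfac ((-1) ^+ b * x) (x ^+ 2) n *
  qfac (x ^+ 2) (x ^+ 2) n ^+ k.
Proof.
pose F (a : nat) : R := \prod_(c < k.+1 | odd a.+1 || (0 < c)%N)
   (1 - (-1) ^+ (b * (odd a.+1 && (c == k :> nat))) * x ^+ a.+1).
transitivity (\prod_(a < n + n) F a).
  by rewrite /F pair_big_dep.
elim: n => [|m IHm]; first by rewrite big_ord0 !qfac0 !expr1n !mulr1.
rewrite addSn addnS 2!big_ord_recr /= {}IHm !qfacS ![(_ * (1 - _)) ^+ k]exprMn.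
have -> : F (m + m)%N = (1 - x * x ^+ 2 ^+ m) ^+ k * (1 - (-1) ^+ b * x * x ^+ 2 ^+ m).
  rewrite /F /= addnn odd_double /= big_ord_recr /= eqxx muln1.
  have -> : x ^+ m.*2.+1 = x * x ^+ 2 ^+ m by rewrite exprS -mul2n exprM.
  rewrite mulrA; congr (_ * _).
  rewrite -[in RHS](card_ord k) -prodr_const; apply: eq_bigr => c _ /=.
  by rewrite (ltn_eqF (ltn_ord c)) muln0 expr0 mul1r.
have -> : F (m + m).+1 = (1 - x ^+ 2 * x ^+ 2 ^+ m) ^+ k.
  rewrite /F /= addnn odd_double /= big_mkcond big_ord_recl /= mul1r.
  rewrite -[in RHS](card_ord k) -prodr_const; apply: eq_bigr => c _ /=.
  by rewrite muln0 expr0 mul1r -exprM -exprD mul2n.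
ring.
Qed.

Lemma N3_eqX (K : numFieldType) (k n : nat) (x : {poly K}) : x = 'X ->
  @eqX K n (\poly_(m < n) (N3 k.+1 m)%:R *
      (qfac x (x ^+ 2) n ^+ k * qfac (x ^+ 2) (x ^+ 2) n ^+ k.+1))
    (x * (qfac (x ^+ 16) (x ^+ 16) n *
       (qfac (- x ^+ 14) (x ^+ 16) n * qfac (- x ^+ 2) (x ^+ 16) n))).
Proof.
move=> xX; case: (posnP n) => [->|n_gt0]; first by rewrite /eqX dvd1p.
have Xx : 'X %| x by rewrite xX.
set S := \poly_(m < n) _; set A := x * _.
set B := qfac x _ n; set C := qfac (x ^+ 2) _ n.
pose Bm := qfac (- x) (x ^+ 2) n.
pose G := genfun k.+1 n x.
have G0 : eqX n (G false * (B ^+ k * B * C ^+ k)) 1.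
  have := genfun_inverse k.+1 n_gt0 false Xx; rewrite prod_allowed.
  by rewrite expr0 mul1r.
have G1 : eqX n (G true * (B ^+ k * Bm * C ^+ k)) 1.
  have := genfun_inverse k.+1 n_gt0 true Xx; rewrite prod_allowed.
  by rewrite expr1 mulN1r.
have SG : eqX n (2 * S) (G false - G true).
  rewrite /eqX -[X in _ %| X](poly_take_drop n) dvdp_add ?dvdp_mull //.
  suff -> : take_poly n (2 * S - (G false - G true)) = 0 by rewrite dvdp0.
  apply/polyP => m; rewrite coef_take_poly coef0; case: ifP => // mn.
  rewrite coefB mulr_natl coefMn coef_poly mn /G xX coef_genfun_diff //.
  by rewrite natrM mulr_natl subrr.
(* With this factor, [B ^+ k * B * Bm * C ^+ k] clears the denominators of both [G false] and
   [G true]. What remains is [C * (Bm - B)], the left side of [odd_part_eqX]. *)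
apply: (@eqX_cancel _ _ (2 * (B * Bm))).
  rewrite /root !hornerM !mulf_neq0 //.
  - by rewrite -polyC_natr hornerC pnatr_eq0.
  - exact: qfac_root0.
  - by apply: qfac_root0; rewrite dvdpNr.
have E : 2 * (B * Bm) * (S * (B ^+ k * C ^+ k.+1)) =
    C * (2 * S * (B ^+ k * B * Bm * C ^+ k)) by rewrite exprS; ring.
rewrite {}E.
apply: eqX_trans (eqXM (eqXxx n C) (eqXM SG (eqXxx n _))) _.
have -> : C * ((G false - G true) * (B ^+ k * B * Bm * C ^+ k)) =
   C * (Bm * (G false * (B ^+ k * B * C ^+ k)) - B * (G true * (B ^+ k * Bm * C ^+ k))).
  ring.
apply: eqX_trans (eqXM (eqXxx n C) (eqXB (eqXM (eqXxx n Bm) G0) (eqXM (eqXxx n B) G1))) _.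
rewrite !mulr1; apply: eqX_trans (odd_part_eqX n Xx) _.
rewrite -/A -/B -/Bm mulrAC; exact: eqXxx.
Qed.

(** * Majorants *)

Section MajorantNorm.
Variables (K : numFieldType) (x : K).
Hypothesis x_ge0 : 0 <= x.
Implicit Types p q : {poly K}.

(** A weighted l^1 norm: submultiplicative, an upper bound for the values on the disc of radius [x],
    and scaled exactly by x^n under multiplication by ['X^n]. *)
Definition majorant p : K := \sum_(i < size p) `|p`_i| * x ^+ i.

Lemma majorant_wide n p : (size p <= n)%N -> majorant p = \sum_(i < n) `|p`_i| * x ^+ i.
Proof.
move=> pn; rewrite /majorant -[RHS](big_mkord xpredT (fun i => `|p`_i| * x ^+ i)).
rewrite (big_cat_nat (n := size p)) //= big_mkord big_nat_cond [X in _ + X]big1 ?addr0 //.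
by move=> i /andP[/andP[pi _] _]; rewrite nth_default // normr0 mul0r.
Qed.

Lemma majorant_le p q : (forall i, `|p`_i| <= `|q`_i|) -> majorant p <= majorant q.
Proof.
move=> pq; pose n := maxn (size p) (size q).
rewrite (@majorant_wide n) ?leq_maxl // (@majorant_wide n q) ?leq_maxr //.
by apply: ler_sum => i _; rewrite ler_wpM2r ?exprn_ge0.
Qed.

Lemma majorant_ge0 p : 0 <= majorant p.
Proof. by apply: sumr_ge0 => i _; rewrite mulr_ge0 ?exprn_ge0. Qed.

Lemma majorantN p : majorant (- p) = majorant p.
Proof. by rewrite /majorant size_polyN; apply: eq_bigr => i _; rewrite coefN normrN. Qed.

Lemma majorantD p q : majorant (p + q) <= majorant p + majorant q.
Proof.
pose n := maxn (size p) (size q).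
rewrite (@majorant_wide n) ?size_polyD // (@majorant_wide n p) ?leq_maxl //.
rewrite (@majorant_wide n q) ?leq_maxr // -big_split /=.
by apply: ler_sum => i _; rewrite -mulrDl ler_wpM2r ?exprn_ge0 // coefD ler_normD.
Qed.

Lemma majorantC c : majorant c%:P = `|c|.
Proof.
rewrite (@majorant_wide 1) ?size_polyC ?leq_b1 // big_ord1 coefC /=.
by rewrite expr0 mulr1.
Qed.

Lemma majorant_mulX p c : majorant (p * 'X + c%:P) = majorant p * x + `|c|.
Proof.
rewrite (@majorant_wide (size p).+1); last first.
  rewrite -cons_poly_def size_cons_poly; case: ifP => //.
rewrite big_ord_recl /= coefD coefMX coefC /= add0r expr0 mulr1 addrC.
congr (_ + _); rewrite /majorant big_distrl; apply: eq_bigr => i _ /=.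
by rewrite /bump /= coefD coefMX coefC /= addr0 exprSr mulrA.
Qed.

Lemma majorantCM c p : majorant (c%:P * p) = `|c| * majorant p.
Proof.
rewrite (@majorant_wide (size p)); last by rewrite mul_polyC size_scale_leq.
rewrite big_distrr /=; apply: eq_bigr => i _.
by rewrite coefCM normrM mulrA.
Qed.

(** Induction along Horner's scheme: ['X] scales by exactly [x], and a constant term costs its
    norm. *)
Lemma majorantM p q : majorant (p * q) <= majorant p * majorant q.
Proof.
elim/poly_ind: p => [|p c IHp].
  by rewrite mul0r /majorant size_poly0 big_ord0 mul0r.
rewrite mulrDl (le_trans (majorantD _ _)) // majorant_mulX mulrDl majorantCM.
rewrite lerD2r mulrAC [p * q * 'X](_ : _ = p * q * 'X + 0%:P); last by rewrite addr0.
by rewrite majorant_mulX normr0 addr0 [leRHS]mulrAC ler_wpM2r.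
Qed.

Lemma majorant1 : majorant 1 = 1.
Proof. by rewrite -[1 in LHS]/(1%:P) majorantC normr1. Qed.

Lemma majorant_prod I (r : seq I) (P : pred I) (F : I -> {poly K}) (G : I -> K) :
  (forall i, P i -> majorant (F i) <= G i) ->
  majorant (\prod_(i <- r | P i) F i) <= \prod_(i <- r | P i) G i.
Proof.
move=> FG; elim: r => [|i r IHr]; first by rewrite !big_nil majorant1.
rewrite !big_cons; case: ifP => // Pi; apply: le_trans (majorantM _ _) _.
by rewrite ler_pM ?majorant_ge0 // FG.
Qed.

Lemma majorant_sum I (r : seq I) (P : pred I) (F : I -> {poly K}) :
  majorant (\sum_(i <- r | P i) F i) <= \sum_(i <- r | P i) majorant (F i).
Proof.
elim: r => [|i r IHr]; first by rewrite !big_nil /majorant size_poly0 big_ord0.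
rewrite !big_cons; case: ifP => // Pi; apply: le_trans (majorantD _ _) _.
by rewrite lerD2l.
Qed.

Lemma majorantX p n : majorant (p ^+ n) <= majorant p ^+ n.
Proof.
rewrite -[n]card_ord -!prodr_const; exact: majorant_prod.
Qed.

Lemma majorant_Xn n : majorant 'X^n = x ^+ n.
Proof.
rewrite /majorant size_polyXn big_ord_recr /= coefXn eqxx normr1 mul1r.
rewrite big1 ?add0r // => i _.
by rewrite coefXn (ltn_eqF (ltn_ord i)) normr0 mul0r.
Qed.

Lemma majorant_MXn p n : majorant (p * 'X^n) = majorant p * x ^+ n.
Proof.
elim: n => [|n IHn]; first by rewrite !expr0 !mulr1.
rewrite exprSr mulrA -[LHS](congr1 majorant (addr0 _)) -[0]/(0%:P) majorant_mulX.
by rewrite IHn normr0 addr0 exprSr mulrA.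
Qed.

Lemma norm_horner_majorant p (q : K) : `|q| <= x -> `|p.[q]| <= majorant p.
Proof.
move=> qx; rewrite horner_coef (le_trans (ler_norm_sum _ _ _)) //.
apply: ler_sum => i _; rewrite normrM normrX ler_wpM2l //.
by rewrite lerXn2r ?nnegrE.
Qed.

End MajorantNorm.

Section EulerBound.
Variables (K : numFieldType) (x : K).
Hypotheses (x_ge0 : 0 <= x) (x_lt1 : x < 1).

(** The truncated Euler product of the partition function. Since 1 + t <= (1 - t)^-1 for t =
    x^(j+1), it bounds the q-products from above, and its inverse bounds them from below. *)
Definition euler (n : nat) : K := \prod_(j < n) (1 - x ^+ j.+1)^-1.

Let pow_lt1 n : 0 < 1 - x ^+ n.+1.
Proof. by rewrite subr_gt0 exprn_ilt1. Qed.

Let pow_inv_ge n : 1 + x ^+ n.+1 <= (1 - x ^+ n.+1)^-1.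
Proof.
rewrite -[leRHS]div1r ler_pdivlMr // mulrC -subr_sqr expr1n gerBl.
by rewrite exprn_ge0 ?exprn_ge0.
Qed.

Let pow_inv_ge1 n : 1 <= (1 - x ^+ n.+1)^-1.
Proof. by rewrite (le_trans _ (pow_inv_ge n)) // lerDl exprn_ge0. Qed.

Lemma euler_ge1 n : 1 <= euler n.
Proof.
apply: (big_ind (fun y => 1 <= y)) => [//|a b|j _]; first exact: mulr_ege1.
exact: pow_inv_ge1.
Qed.

Lemma qfac_term_le (a Q : K) j : 0 <= a <= x -> 0 <= Q <= x -> a * Q ^+ j <= x ^+ j.+1.
Proof.
move=> /andP[a0 ax] /andP[Q0 Qx]; rewrite exprS ler_pM ?exprn_ge0 //.
by rewrite lerXn2r ?nnegrE.
Qed.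

Lemma norm_qfac_le (a Q : K) n : `|a| <= x -> `|Q| <= x -> `|qfac a Q n| <= euler n.
Proof.
move=> ax Qx; rewrite /qfac big_mkord normr_prod.
apply: ler_prod => j _; rewrite normr_ge0 (le_trans (ler_normB _ _)) // normr1.
rewrite (le_trans _ (pow_inv_ge j)) // lerD2l normrM normrX.
by rewrite qfac_term_le ?normr_ge0.
Qed.

Lemma norm_qfac_ge (a Q : K) n :
  `|a| <= x -> `|Q| <= x -> (euler n)^-1 <= `|qfac a Q n|.
Proof.
move=> ax Qx; rewrite /qfac big_mkord normr_prod -prodfV.
apply: ler_prod => j _; rewrite invrK ltW //=.
rewrite (le_trans _ (lerB_dist _ _)) // normr1 lerD2l lerN2 normrM normrX.
by rewrite qfac_term_le ?normr_ge0.
Qed.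

Lemma majorant_qfac (a Q : {poly K}) n :
  majorant x a <= x -> majorant x Q <= x -> majorant x (qfac a Q n) <= euler n.
Proof.
move=> ax Qx; rewrite /qfac big_mkord.
apply: majorant_prod => // j _; apply: le_trans (majorantD _ _ _) _ => //.
rewrite majorantN majorant1 (le_trans _ (pow_inv_ge j)) // lerD2l.
rewrite (le_trans (majorantM _ _ _)) //.
rewrite (le_trans (ler_wpM2l _ (majorantX _ _ _))) ?majorant_ge0 //.
by rewrite qfac_term_le ?majorant_ge0.
Qed.

(** Dropping the restriction on even parts leaves one Euler product per color. *)
Lemma majorant_genfun k n : majorant x (genfun k n 'X false) <= euler (n + n) ^+ k.
Proof.
have -> : euler (n + n) ^+ k =
    \prod_(i : 'I_(n + n) * 'I_k) (1 - x ^+ part i)^-1.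
  rewrite -(pair_bigA _ (fun (a : 'I_(n + n)) (c : 'I_k) => (1 - x ^+ a.+1)^-1)) /=.
  by rewrite -prodrXl; apply: eq_bigr => a _; rewrite prodr_const card_ord.
apply: majorant_prod => // i _; apply: le_trans (majorant_sum _ _ _ _) _ => //.
apply: (@le_trans _ _ (\sum_(j < n) (x ^+ part i) ^+ j)).
  rewrite big_mkcond; apply: ler_sum => j _; case: ifP => _; last by rewrite !exprn_ge0.
  rewrite /twist mul0n expr0 mul1r (le_trans (majorantX _ _ _)) //.
  by rewrite majorant_Xn.
rewrite -[leRHS]div1r ler_pdivlMr; last exact: pow_lt1.
by rewrite mulrC -[1 - _]opprB mulNr -subrX1 opprB gerBl !exprn_ge0.
Qed.

Lemma majorant_N3 k n : majorant x (\poly_(m < n) (N3 k m)%:R) <= euler (n + n) ^+ k.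
Proof.
case: (posnP n) => [->|n_gt0].
  by rewrite poly_def big_ord0 /majorant size_poly0 big_ord0 exprn_ge0 // (le_trans _ (euler_ge1 _)).
apply: le_trans (majorant_genfun k n); apply: majorant_le => // m.
rewrite coef_poly; case: ifP => mn; last by rewrite normr0.
have le_gf := @N3_le_coef_genfun k n n_gt0 K m mn.
by rewrite !ger0_norm // (le_trans _ le_gf).
Qed.

End EulerBound.

(** * The error of the truncated identity at a point *)

Lemma horner_qfac (K : comNzRingType) (a Q : {poly K}) (q : K) n :
  (qfac a Q n).[q] = qfac a.[q] Q.[q] n.
Proof. by elim: n => [|n IHn]; rewrite ?qfac0 ?hornerE // !qfacS -IHn !hornerE. Qed.

Definition theta_qfac (R : comNzRingType) (q : R) (n : nat) : R :=
  qfac (q ^+ 16) (q ^+ 16) n * (qfac (- q ^+ 14) (q ^+ 16) n * qfac (- q ^+ 2) (q ^+ 16) n).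

Definition denominator_qfac (R : comNzRingType) (k : nat) (q : R) (n : nat) : R :=
  qfac q (q ^+ 2) n ^+ k * qfac (q ^+ 2) (q ^+ 2) n ^+ k.+1.

Lemma N3_error (K : numFieldType) (x q M : K) (k n : nat) :
  0 < x -> x < 1 -> `|q| <= x -> (forall n, euler x n <= M) ->
  `|\sum_(0 <= m < n) (N3 k.+1 m)%:R * q ^+ m * denominator_qfac k q n -
    q * theta_qfac q n| <=
  (`|q| / x) ^+ n * (M ^+ k.+1 * (M ^+ k * M ^+ k.+1) + x * (M * (M * M))).
Proof.
move=> x_gt0 x1 qx EM; have x0 := ltW x_gt0.
have M0 : 0 <= M by rewrite (le_trans _ (EM 0%N)) // (le_trans _ (euler_ge1 _ _ _)).
pose S : {poly K} := \poly_(m < n) (N3 k.+1 m)%:R.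
pose T := S * denominator_qfac k 'X n - 'X * theta_qfac 'X n.
have -> : \sum_(0 <= m < n) (N3 k.+1 m)%:R * q ^+ m * denominator_qfac k q n -
    q * theta_qfac q n = T.[q].
  rewrite /T /denominator_qfac /theta_qfac !hornerE !horner_qfac !hornerE.
  by congr (_ - _); rewrite -mulr_suml big_mkord /S horner_poly; exact: mulrA.
have /dvdpP[r TE] : 'X^n %| T by exact: N3_eqX.
(* Each q-product costs a factor M, the [N3] polynomial on k + 1 colors costs M^(k+1), and the
   factor ['X] costs x. *)
have TM : majorant x T <= M ^+ k.+1 * (M ^+ k * M ^+ k.+1) + x * (M * (M * M)).
  have Xx i : majorant x 'X^(i.+1) <= x.
    by rewrite majorant_Xn exprS ger_pMr // exprn_ile1 // ltW.
  have X1 : majorant x 'X <= x := Xx 0%N.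
  have qfacM a Q : majorant x a <= x -> majorant x Q <= x -> majorant x (qfac a Q n) <= M.
    by move=> ax Qx; apply: le_trans (EM n); apply: majorant_qfac.
  have mulM (a b : {poly K}) (A B : K) : majorant x a <= A -> majorant x b <= B ->
      majorant x (a * b) <= A * B.
    by move=> aA bB; apply: le_trans (majorantM _ _ _) _ => //; rewrite ler_pM ?majorant_ge0.
  have expM (a : {poly K}) i : majorant x a <= M -> majorant x (a ^+ i) <= M ^+ i.
    move=> aM; apply: le_trans (majorantX _ _ _) _ => //.
    by rewrite lerXn2r ?nnegrE ?majorant_ge0.
  apply: le_trans (majorantD _ _ _) _ => //; rewrite majorantN.
  apply: lerD; last by do 3?apply: (mulM) => //; apply: qfacM; rewrite ?majorantN.
  apply: (mulM); last by apply: (mulM); apply: expM; apply: qfacM.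
  apply: le_trans (majorant_N3 _ _ _ _) _ => //.
  by rewrite lerXn2r ?nnegrE // (le_trans _ (euler_ge1 _ _ _)).
(* The quotient [r] of [T] by ['X^n] has majorant equal to that of [T] divided by x^n, and this
   bounds [r.[q]]. *)
rewrite TE majorant_MXn // in TM; rewrite TE hornerM hornerXn normrM normrX.
rewrite expr_div_n mulrAC mulrC -mulrA ler_wpM2l ?exprn_ge0 //.
by rewrite ler_pdivlMr ?exprn_gt0 // (le_trans _ TM) // ler_wpM2r ?exprn_ge0 // norm_horner_majorant.
Qed.

(** * Limits of complex sequences *)

Lemma euler_bounded (R : realType) (y : R) : 0 <= y -> y < 1 ->
  exists M, forall n, euler y n <= M.
Proof.
move=> y0 y1; have y1' : 0 < 1 - y by rewrite subr_gt0.
(* For t = y^(j+1), (1 - t)^-1 = 1 + t / (1 - t) <= exp(t / (1 - y)); the t sum to at most y / (1 -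
   y) <= 1 / (1 - y). *)
exists (expR ((1 - y)^-1 * (1 - y)^-1)) => n.
apply: (@le_trans _ _ (\prod_(j < n) expR ((1 - y)^-1 * y ^+ j.+1))).
  apply: ler_prod => j _; have yj : 0 <= y ^+ j.+1 by rewrite exprn_ge0.
  have yjy : y ^+ j.+1 <= y by rewrite exprS ler_piMr // exprn_ile1 // ltW.
  have yj1 : 0 < 1 - y ^+ j.+1 by rewrite subr_gt0 (le_lt_trans yjy).
  rewrite invr_ge0 ltW //= (le_trans _ (expR_ge1Dx _)) //.
  have -> : (1 - y ^+ j.+1)^-1 = 1 + (1 - y ^+ j.+1)^-1 * y ^+ j.+1.
    by field; rewrite gt_eqF.
  by rewrite lerD2l ler_wpM2r // lef_pV2 ?posrE // lerD2l lerN2.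
rewrite -expR_sum ler_expR -mulr_sumr ler_wpM2l ?invr_ge0 ?(ltW y1') //.
rewrite -[leRHS]div1r ler_pdivlMr // mulrC.
under eq_bigr do rewrite exprS.
rewrite -mulr_sumr mulrCA -opprB mulNr -subrX1 opprB.
rewrite mulrBr mulr1 (le_trans _ (ltW y1)) // gerBl mulr_ge0 // exprn_ge0 //.
Qed.

Section ComplexLimits.
Variable R : realType.
Local Notation K := (complexField R).
Local Notation "y %:C" := (real_complex R y : K) (format "y %:C") : ring_scope.

Lemma euler_real (y : R) n : euler y%:C n = (euler y n)%:C.
Proof.
rewrite /euler rmorph_prod; apply: eq_bigr => j _.
by rewrite fmorphV rmorphB rmorph1 rmorphXn.
Qed.

Lemma norm_real (z : K) : exists2 y : R, 0 <= y & `|z| = y%:C.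
Proof.
exists (Num.sqrt (complex.Re z ^+ 2 + complex.Im z ^+ 2)); first exact: sqrtr_ge0.
exact: (@normc_def R z).
Qed.

(** A positive element of the complex field equals its norm, hence is real, so smallness can be
    tested in [R]. *)
Lemma cvg_complex0 (u : nat -> K) (v : nat -> R) :
  (forall n, `|u n| <= (v n)%:C) -> v @ \oo --> (0 : R) -> u @ \oo --> (0 : K).
Proof.
move=> uv v0; apply/cvgr0Pnorm_lt => e e_gt0.
have [y y0 ye] := norm_real e.
rewrite gtr0_norm // in ye; rewrite ye in e_gt0 *.
move: e_gt0; rewrite ltcR => {}y0.
have /cvgr0Pnorm_lt /(_ _ y0) := v0; apply: filterS => n vny.
by rewrite (le_lt_trans (uv n)) // ltcR (le_lt_trans (ler_norm _)).
Qed.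

(** The sequence is its first term plus a telescoping series dominated by a geometric one. *)
Lemma geometric_cauchy_cvg (w : nat -> R) (C r : R) : 0 <= r -> r < 1 ->
  (forall n, `|w n.+1 - w n| <= C * r ^+ n) -> cvgn w.
Proof.
move=> r0 r1 wr; rewrite (funext (eq_sum_telescope w)); apply: is_cvgD.
  exact: is_cvg_cst.
apply: normed_cvg; apply: (@series_le_cvg _ _ (geometric C r)) => //.
- by move=> n /=.
- by move=> n; rewrite /= (le_trans _ (wr n)).
- by apply: is_cvg_geometric_series; rewrite ger0_norm.
Qed.

Lemma norm_Im_le (z : K) : `|complex.Im z|%:C <= `|z|.
Proof.
apply: le_trans (_ : _ <= (Num.sqrt (complex.Re z ^+ 2 + complex.Im z ^+ 2))%:C) _.
  by rewrite lecR -sqrtr_sqr ler_wsqrtr // lerDr sqr_ge0.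
by rewrite [X in _ <= X](@normc_def R z).
Qed.

Lemma norm_le_ReIm (z : K) : `|z| <= (`|complex.Re z| + `|complex.Im z|)%:C.
Proof.
rewrite [X in X <= _](@normc_def R z) lecR.
rewrite -[leRHS]ger0_norm ?addr_ge0 // -[leRHS]sqrtr_sqr ler_wsqrtr //.
rewrite sqrrD !real_normK ?num_real // addrAC lerDl.
by rewrite mulrn_wge0 // mulr_ge0.
Qed.

Lemma geometric_cauchy_cvg_complex (u : nat -> K) (C r : R) : 0 <= r -> r < 1 ->
  (forall n, `|u n.+1 - u n| <= (C * r ^+ n)%:C) -> cvgn u.
Proof.
move=> r0 r1 ur.
have /cvg_ex[a /= Ra] : cvgn (fun n => complex.Re (u n)).
  apply: (@geometric_cauchy_cvg _ C r) => // n; rewrite -lecR -raddfB.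
  exact: le_trans (@normc_ge_Re R _) (ur n).
have /cvg_ex[b /= Ib] : cvgn (fun n => complex.Im (u n)).
  apply: (@geometric_cauchy_cvg _ C r) => // n; rewrite -lecR -raddfB.
  exact: le_trans (norm_Im_le _) (ur n).
suff : u @ \oo --> (Complex a b : K) by move=> /cvgP.
apply: (subr_cvg0 u (Complex a b : K)).1.
apply: (@cvg_complex0 _ (fun n => `|complex.Re (u n) - a| + `|complex.Im (u n) - b|)).
  move=> n; apply: le_trans (norm_le_ReIm _) _.
  by rewrite lecR; case: (u n).
rewrite -[0]addr0; apply: cvgD; rewrite -[0](normr0 R).
  by apply: cvg_norm; apply/subr_cvg0.
by apply: cvg_norm; apply/subr_cvg0.
Qed.

Lemma cvg_exprn (u : nat -> K) (l : K) i : u @ \oo --> l -> (fun n => u n ^+ i) @ \oo --> l ^+ i.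
Proof.
move=> ul; elim: i => [|i IHi]; first exact: cvg_cst.
rewrite exprS; under eq_fun do rewrite exprS.
exact: cvgM.
Qed.

Section Products.
Variables (y M : R).
Hypotheses (y0 : 0 < y) (y1 : y < 1) (yM : forall n, euler y n <= M).
Let x : K := y%:C.
Let x0 : 0 <= x. Proof. by rewrite /x -[0]/(0%:C) lecR ltW. Qed.
Let x1 : x < 1. Proof. by rewrite /x -[1]/(1%:C) ltcR. Qed.
Let xM n : euler x n <= M%:C. Proof. by rewrite euler_real lecR. Qed.

(** Consecutive partial products differ by [qfac a Q n * (a * Q ^+ n)], of norm at most M y^(n+1).
    Hence the limit defining [qpoch] is a genuine one. *)
Lemma cvg_qfac (a Q : K) : `|a| <= x -> `|Q| <= x -> qfac a Q @ \oo --> qpoch a Q.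
Proof.
move=> ax Qx; apply: (@geometric_cauchy_cvg_complex (qfac a Q) (M * y) y _ y1).
  exact: ltW.
move=> n; rewrite qfacS mulrBr mulr1 addrAC subrr add0r normrN normrM.
rewrite -mulrA -exprS rmorphM rmorphXn ler_pM //.
  by apply: le_trans (xM n); apply: norm_qfac_le.
by rewrite normrM normrX qfac_term_le // normr_ge0.
Qed.

(** The partial products stay at distance at least 1/M from 0. *)
Lemma qpoch_neq0 (a Q : K) : `|a| <= x -> `|Q| <= x -> qpoch a Q != 0.
Proof.
move=> ax Qx; apply/eqP => aQ0.
have M_gt0 : 0 < M by rewrite (lt_le_trans _ (yM 0)) // /euler big_ord0.
have := cvg_qfac ax Qx; rewrite aQ0 => /cvgr0Pnorm_lt /(_ (M^-1)%:C).
rewrite -[0]/(0%:C) ltcR invr_gt0 => /(_ M_gt0) [n _ /(_ n (leqnn n)) /= lt_n].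
suff : `|qfac a Q n| < `|qfac a Q n| by rewrite ltxx.
apply: lt_le_trans lt_n _; apply: le_trans (norm_qfac_ge x0 x1 n ax Qx).
have e_gt0 m : 0 < euler x m by rewrite (lt_le_trans _ (euler_ge1 x0 x1 m)).
have M'_gt0 : (0 : K) < M%:C by rewrite (lt_le_trans _ (xM 0)).
by rewrite fmorphV lef_pV2 ?posrE.
Qed.

End Products.

End ComplexLimits.

(** * Passage to the limit *)

Lemma qpochs3 (K : numFieldType) (a b c Q : K) :
  qpochs [:: a; b; c] Q = qpoch a Q * (qpoch b Q * qpoch c Q).
Proof. by rewrite /qpochs !big_cons big_nil mulr1. Qed.

Theorem theorem1p15 (R : realType) (k : nat) (hk : (1 <= k)%N)
    (q : complexField R) (hq : `|q| < 1) :
  series (fun n : nat => (N3 k n)%:R * q ^+ n) @ \oo -->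
    q * (qpochs [:: q ^+ 16; - q ^+ 2; - q ^+ 14] (q ^+ 16) /
         (qpoch q (q ^+ 2) ^+ (k - 1) * qpoch (q ^+ 2) (q ^+ 2) ^+ k)).
Proof.
case: k hk => // k _; rewrite subn1 /=.
have [y0 y0_ge0 qy0] := norm_real q.
have y0_lt1 : y0 < 1 by move: hq; rewrite qy0 -[1]/(real_complex R 1) ltcR.
(* The midpoint of |q| and 1 is positive even when q = 0, so |q| / y makes sense and is below 1. *)
have [y [y_gt0 y_lt1 y0y]] : exists y : R, [/\ 0 < y, y < 1 & y0 < y].
  by exists ((1 + y0) / 2); split; lra.
have [M yM] := euler_bounded (ltW y_gt0) y_lt1.
pose x : complexField R := real_complex R y.
have x_gt0 : 0 < x by rewrite /x -[0]/(real_complex R 0) ltcR.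
have x_lt1 : x < 1 by rewrite /x -[1]/(real_complex R 1) ltcR.
have qx : `|q| <= x by rewrite qy0 /x lecR ltW.
have qXx i : `|q ^+ i.+1| <= x.
  by rewrite normrX exprS (le_trans _ qx) // ler_piMr // exprn_ile1 // ltW.
have qNXx i : `|- q ^+ i.+1| <= x by rewrite normrN.
have qfacC := @cvg_qfac R y M y_gt0 y_lt1 yM.
pose A := q * (qpoch (q ^+ 16) (q ^+ 16) *
  (qpoch (- q ^+ 14) (q ^+ 16) * qpoch (- q ^+ 2) (q ^+ 16))).
pose D := qpoch q (q ^+ 2) ^+ k * qpoch (q ^+ 2) (q ^+ 2) ^+ k.+1.
(* The summand 0 is the limit of the error term, in the shape that [SE] gives to [S]. *)
have -> : q * (qpochs [:: q ^+ 16; - q ^+ 2; - q ^+ 14] (q ^+ 16) / D) = (0 + A) * D^-1.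
  rewrite add0r mulrA; congr (_ / D).
  by rewrite qpochs3 [X in _ = _ * (_ * X)]mulrC.
have D_neq0 : D != 0.
  by rewrite mulf_neq0 // expf_neq0 // (qpoch_neq0 y_gt0 y_lt1 yM).
have cvgD' : denominator_qfac k q @ \oo --> D.
  by apply: cvgM; apply: cvg_exprn; apply: qfacC.
have cvgA : (fun n => q * theta_qfac q n) @ \oo --> A.
  apply: cvgM; first exact: cvg_cst.
  by do 2?apply: cvgM; apply: qfacC.
pose S := series (fun n : nat => (N3 k.+1 n)%:R * q ^+ n).
have err0 : (fun n => S n * denominator_qfac k q n - q * theta_qfac q n) @ \oo --> (0 : complexField R).
  pose C := M ^+ k.+1 * (M ^+ k * M ^+ k.+1) + y * (M * (M * M)).
  apply: (@cvg_complex0 R _ (fun n => (y0 / y) ^+ n * C)).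
    move=> n; rewrite /S /series /= mulr_suml.
    have xM m : euler x m <= real_complex R M by rewrite euler_real lecR.
    apply: le_trans (N3_error k n x_gt0 x_lt1 qx xM) _.
    by rewrite qy0 /C !(rmorphM, rmorphXn, rmorphD, fmorphV).
  rewrite -(mul0r C); apply: cvgMl.
  apply: cvg_expr; rewrite ger0_norm ?divr_ge0 // ?(ltW y_gt0) //.
  by rewrite ltr_pdivrMr // mul1r.
(* Solving the truncated identity for [S] requires each finite denominator to be nonzero, which
   [norm_qfac_ge] provides. *)
rewrite -/S; have SE : S = (fun n => (S n * denominator_qfac k q n - q * theta_qfac q n +
   q * theta_qfac q n) * (denominator_qfac k q n)^-1).
  apply/funext => n; rewrite subrK mulfK //.
  have e_gt0 : 0 < (euler x n)^-1.
    by rewrite invr_gt0 (lt_le_trans _ (euler_ge1 (ltW x_gt0) x_lt1 n)).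
  have qfac_neq0 (a Q : complexField R) : `|a| <= x -> `|Q| <= x -> qfac a Q n != 0.
    move=> ax Qx; rewrite -normr_gt0 (lt_le_trans e_gt0) //.
    exact: (@norm_qfac_ge _ x (ltW x_gt0) x_lt1 a Q n ax Qx).
  by rewrite mulf_neq0 // expf_neq0 // qfac_neq0.
rewrite SE; apply: cvgM; first exact: cvgD err0 cvgA.
exact: (cvgV D_neq0 cvgD').
Qed.
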